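(* Let $A$ be a recursively enumerable set of integers. Then there is a countably generated recursive presentation $Q$ of a group $\overline{Q}$ which is $A$-torsion-free and contains an embedded copy of every countably generated recursively presentable $A$-torsion-free group.
   Context: A countably generated recursive presentation $\langle X \mid R\rangle$ is a group presentation where $X$ is a recursively enumerated set of generators and $R$ is a recursive enumeration of relators; $\overline{P}$ denotes the group it presents. A group is countably generated recursively presentable if it is isomorphic to $\overline{P}$ for some countably generated recursive presentation $P$. For a group $G$ and set of integers $A$, $G$ is $A$-torsion-free if there is no $g \neq e$ in $G$ with $g^{n} = e$ for some $n \in A$. *)

(* Defs.v *)
From Stdlib Require Import List.
From mathcomp Require Import all_boot all_order all_algebra.
Set Implicit Arguments.
Unset Strict Implicit.
Unset Printing Implicit Defensive.

(* Arguments are passed as a list of naturals; arity is implicit. *)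
Inductive recfun : Type :=
| rf_zero : recfun
| rf_succ : recfun
| rf_proj : nat -> recfun
| rf_comp : recfun -> list recfun -> recfun
| rf_prec : recfun -> recfun -> recfun
| rf_min  : recfun -> recfun.

Inductive reval : recfun -> seq nat -> nat -> Prop :=
| re_zero v : reval rf_zero v 0
| re_succ v : reval rf_succ v (nth 0 v 0).+1
| re_proj i v : reval (rf_proj i) v (nth 0 v i)
| re_comp f gs v ys y :
    Forall2 (fun g y => reval g v y) gs ys ->
    reval f ys y -> reval (rf_comp f gs) v y
| re_prec0 f g v y : reval f v y -> reval (rf_prec f g) (0 :: v) y
| re_precS f g x v r y :
    reval (rf_prec f g) (x :: v) r -> reval g (x :: r :: v) y ->
    reval (rf_prec f g) (x.+1 :: v) y
| re_min f v y :
    reval f (y :: v) 0 ->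
    (forall z, z < y -> exists k, reval f (z :: v) k.+1) ->
    reval (rf_min f) v y.

Definition re_nat (S : nat -> Prop) : Prop :=
  exists f : recfun, forall n, S n <-> exists y, reval f [:: n] y.

Definition re_set (T : countType) (S : T -> Prop) : Prop :=
  re_nat (fun n => exists x : T, pickle x = n /\ S x).

(* A letter (x, false) is the generator x, (x, true) is its inverse x^-1. *)
Definition letter := (nat * bool)%type.
Definition word := seq letter.

Definition linv (l : letter) : letter := (l.1, ~~ l.2).
Definition winv (w : word) : word := rev (map linv w).

Definition wpow (w : word) (n : int) : word :=
  match n with
  | Posz k => flatten (nseq k w)
  | Negz k => flatten (nseq k.+1 (winv w))
  end.

Record presentation := Presentation {
  gens : nat -> Prop;
  rels : word -> Prop;
  rels_over : forall r, rels r -> forall l, l \in r -> gens l.1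
}.

Definition word_over (P : presentation) (w : word) : Prop :=
  forall l, l \in w -> gens P l.1.

(* Equality in the presented group: the congruence on words generated by
   free cancellation and the relators. *)
Inductive peq (P : presentation) : word -> word -> Prop :=
| peq_refl u : peq P u u
| peq_sym u v : peq P u v -> peq P v u
| peq_trans u v w : peq P u v -> peq P v w -> peq P u w
| peq_ctx a u v c : peq P u v -> peq P (a ++ u ++ c) (a ++ v ++ c)
| peq_cancel l : peq P [:: l; linv l] [::]
| peq_rel r : rels P r -> peq P r [::].

Definition recursive_pres (P : presentation) : Prop :=
  re_set (gens P) /\ re_set (rels P).

Definition torsion_free (A : int -> Prop) (P : presentation) : Prop :=
  forall w, word_over P w -> forall n, A n ->
    peq P (wpow w n) [::] -> peq P w [::].

Definition hom_word (phi : nat -> word) (w : word) : word :=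
  flatten (map (fun l => if l.2 then winv (phi l.1) else phi l.1) w).

(* The group presented by P embeds in the group presented by Q: there is a
   well-defined injective homomorphism, given on generators by phi. *)
Definition embeds (P Q : presentation) : Prop :=
  exists phi : nat -> word,
    [/\ forall x, gens P x -> word_over Q (phi x),
        forall r, rels P r -> peq Q (hom_word phi r) [::]
      & forall w, word_over P w -> peq Q (hom_word phi w) [::] -> peq P w [::]].

(* Main.v *)
(** Take one copy of the generators for every code of a recursive function, impose
    on copy i the relators accepted by the function coded by i, and close under
    extraction of A-roots of the identity; the relators of Q are all the words that
    become trivial. Q is A-torsion-free by construction. If P is A-torsion-free and
    its relators are accepted by the function coded by i, killing the other copies
    respects the root rule because its image lies in P, so it defines a retraction
    of Q onto P and P embeds. Neither normal forms in free products nor the torsion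
    theorem for them are needed.

    That the trivial words are recursively enumerable follows from a general fact:
    the least relation closed under finitely many Horn clauses over numbers built
    from successor and pairing is recursively enumerable. Evaluation of recursive
    functions (hence a universal function) and equality of words in Q are given by
    one such system of clauses. *)

From Stdlib Require Import List ClassicalEpsilon.
From HB Require Import structures.
Require Import Defs.
From mathcomp Require Import all_boot all_order all_algebra.
From mathcomp Require Import zify.
Set Implicit Arguments.
Unset Strict Implicit.
Unset Printing Implicit Defensive.

(** * Evaluation of recursive functions: induction and determinism *)

(** Evaluations nested in [Forall2] and under the existential of minimisation need induction
    hypotheses as well, so the recursion runs directly on the evaluation derivation. *)
Lemma reval_nested_ind (P : recfun -> seq nat -> nat -> Prop) :
  (forall v, P rf_zero v 0) ->
  (forall v, P rf_succ v (nth 0 v 0).+1) ->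
  (forall i v, P (rf_proj i) v (nth 0 v i)) ->
  (forall f gs v ys y, Forall2 (fun g y => P g v y) gs ys ->
    P f ys y -> P (rf_comp f gs) v y) ->
  (forall f g v y, P f v y -> P (rf_prec f g) (0 :: v) y) ->
  (forall f g x v r y, P (rf_prec f g) (x :: v) r -> P g (x :: r :: v) y ->
    P (rf_prec f g) (x.+1 :: v) y) ->
  (forall f v y, P f (y :: v) 0 ->
    (forall z, z < y -> exists k, P f (z :: v) k.+1) -> P (rf_min f) v y) ->
  forall f v y, reval f v y -> P f v y.
Proof.
move=> Pz Ps Pp Pc P0 PS Pm; fix IH 4 => f v y [].
- exact: Pz.
- exact: Ps.
- exact: Pp.
- move=> {}f gs {}v ys {}y Hgs Hf; apply: (Pc _ _ _ ys); last exact: IH.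
  by elim: Hgs => {gs ys Hf}; constructor => //; apply: IH.
- by move=> {}f g {}v {}y H; apply/P0/IH.
- by move=> {}f g x {}v r {}y H1 H2; apply: PS; apply: IH; eassumption.
- move=> {}f {}v {}y H0 H; apply: Pm; first exact: IH.
  by move=> z /H[k Hk]; exists k; apply: IH.
Qed.

Lemma reval_functional f v y z : reval f v y -> reval f v z -> y = z.
Proof.
move=> H; move: f v y H z; apply: reval_nested_ind.
- by move=> v z H; inversion H.
- by move=> v z H; inversion H.
- by move=> i v z H; inversion H.
- move=> f gs v ys y Hgs Hf z H; inversion H as [| | |? ? ? zs ? Hz Hfz| | |].
  subst; apply: Hf; suff -> : ys = zs by [].
  elim: Hgs zs Hz {H Hfz} => [|g a gs' ys' Hg _ IH] zs Hz; inversion Hz => //.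
  by subst; congr (_ :: _); [apply: Hg | apply: IH].
- by move=> f g v y IH z H; inversion H; subst; apply: IH.
- move=> f g x v r y IHr IHy z H; inversion H; subst.
  by apply: IHy; rewrite (IHr r0).
- move=> f v y IH0 IH z H; inversion H as [| | | | | |? ? ? Hz0 Hz]; subst.
  (* If the two minima differed, [f] would be both zero and positive at the smaller one. *)
  case: (ltngtP y z) => // lt.
    by have [k /IH0] := Hz _ lt.
  by have [k /(_ _ Hz0)] := IH _ lt.
Qed.

(** * Computable functions *)

(** Argument lists of every length are allowed; reading them by [nth] with default 0 avoids tracking
    arities. *)
Definition computable (F : seq nat -> nat) : Prop :=
  exists f, forall v, reval f v (F v).
Definition computable1 (F : nat -> nat) : Prop :=
  computable (fun v => F (nth 0 v 0)).
Definition computable2 (F : nat -> nat -> nat) : Prop :=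
  computable (fun v => F (nth 0 v 0) (nth 0 v 1)).
Definition computable3 (F : nat -> nat -> nat -> nat) : Prop :=
  computable (fun v => F (nth 0 v 0) (nth 0 v 1) (nth 0 v 2)).

Lemma computable_ext F G : F =1 G -> computable F -> computable G.
Proof. by move=> E [f Hf]; exists f => v; rewrite -E. Qed.

Lemma computable_nth i : computable (fun v => nth 0 v i).
Proof. by exists (rf_proj i) => v; constructor. Qed.

Lemma computable_comp1 F G1 :
  computable1 F -> computable G1 -> computable (fun v => F (G1 v)).
Proof.
move=> [f Hf] [g1 H1]; exists (rf_comp f [:: g1]) => v.
apply: (re_comp (ys := [:: G1 v])); last exact: (Hf [:: G1 v]).
by repeat constructor.
Qed.

Lemma computable_comp2 F G1 G2 :
  computable2 F -> computable G1 -> computable G2 ->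
  computable (fun v => F (G1 v) (G2 v)).
Proof.
move=> [f Hf] [g1 H1] [g2 H2]; exists (rf_comp f [:: g1; g2]) => v.
apply: (re_comp (ys := [:: G1 v; G2 v])); last exact: (Hf [:: G1 v; G2 v]).
by repeat constructor.
Qed.

Lemma computable_S G : computable G -> computable (fun v => (G v).+1).
Proof. by apply: computable_comp1; exists rf_succ => v; constructor. Qed.

Lemma computable_const n : computable (fun=> n).
Proof.
elim: n => [|n]; last exact: computable_S.
by exists rf_zero => v; constructor.
Qed.

(** Evaluation of [rf_prec] inspects the head of its argument list, so two projections first rebuild
    a list of exactly two entries. *)
Lemma computable_primrec G B S :
  (forall a, G 0 a = B a) -> (forall x a, G x.+1 a = S x (G x a) a) ->
  computable1 B -> computable3 S -> computable2 G.
Proof.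
move=> G0 GS [b Hb] [s Hs].
exists (rf_comp (rf_prec b s) [:: rf_proj 0; rf_proj 1]) => v.
apply: (re_comp (ys := [:: nth 0 v 0; nth 0 v 1])); first by repeat constructor.
elim: (nth 0 v 0) (nth 0 v 1) => [|x IH] a.
  by rewrite G0; constructor; apply: (Hb [:: a]).
by rewrite GS; apply: re_precS (IH a) _; apply: (Hs [:: x; G x a; a]).
Qed.

Ltac computable_basic :=
  repeat first [ apply: computable_nth | apply: computable_const
               | apply: computable_S ].

Lemma computable_pred G : computable G -> computable (fun v => (G v).-1).
Proof.
move=> cG; apply: (computable_comp2 (F := fun x _ => x.-1) _ cG cG).
by apply: (computable_primrec (B := fun=> 0) (S := fun x _ _ => x)) => //;
  computable_basic.
Qed.

Lemma computable_add F G :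
  computable F -> computable G -> computable (fun v => F v + G v).
Proof.
apply: computable_comp2.
by apply: (computable_primrec (B := id) (S := fun _ r _ => r.+1)) => //;
  computable_basic.
Qed.

Lemma computable_mul F G :
  computable F -> computable G -> computable (fun v => F v * G v).
Proof.
apply: computable_comp2.
apply: (computable_primrec (B := fun=> 0) (S := fun _ r a => a + r)) => //.
  by computable_basic.
by apply: computable_add; computable_basic.
Qed.

Lemma computable_sub F G :
  computable F -> computable G -> computable (fun v => F v - G v).
Proof.
(* Recursion runs on the first argument, so the subtrahend is put there. *)
move=> cF cG; apply: (computable_comp2 (F := fun y x => x - y)) => //.
apply: (computable_primrec (B := id) (S := fun _ r _ => r.-1)).
- exact: subn0.
- by move=> x a; rewrite subnS.
- by computable_basic.
by apply: computable_pred; computable_basic.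
Qed.

Lemma computable_eq0 F : computable F -> computable (fun v => (F v == 0) : nat).
Proof.
move=> cF; have := computable_sub (computable_const 1) cF.
by apply: computable_ext => v; case: (F v).
Qed.

(** One of the two truncated differences is zero and the other is the distance; testing their sum
    for zero twice yields the indicator. *)
Lemma computable_neq F G :
  computable F -> computable G -> computable (fun v => (F v != G v) : nat).
Proof.
move=> cF cG; have c := computable_add (computable_sub cF cG) (computable_sub cG cF).
apply: computable_ext (computable_eq0 (computable_eq0 c)) => v.
by rewrite addn_eq0 !subn_eq0 -eqn_leq; case: (F v == G v).
Qed.

Lemma computable_if_eq0 C F G :
  computable C -> computable F -> computable G ->
  computable (fun v => if C v == 0 then F v else G v).
Proof.
move=> cC cF cG.
have c0 := computable_eq0 cC; have c1 := computable_eq0 c0.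
apply: computable_ext (computable_add (computable_mul c0 cF) (computable_mul c1 cG)).
by move=> v; case: (C v) => [|n]; rewrite /= ?mul1n ?mul0n ?addn0.
Qed.

Lemma computable_iter f N F :
  computable1 f -> computable N -> computable F ->
  computable (fun v => iter (N v) f (F v)).
Proof.
move=> cf; apply: (computable_comp2 (F := fun n x => iter n f x)).
apply: (computable_primrec (B := id) (S := fun _ r _ => f r)) => //.
  by computable_basic.
by apply: computable_comp1 => //; computable_basic.
Qed.

Lemma computable_odd F : computable F -> computable (fun v => odd (F v) : nat).
Proof.
move=> cF; apply: (computable_comp2 (F := fun x _ => odd x : nat) _ cF cF).
apply: (computable_primrec (B := fun=> 0) (S := fun _ r _ => (r == 0) : nat)).
- by [].
- by move=> x _ /=; case: (odd x).
- by computable_basic.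
by apply: computable_eq0; computable_basic.
Qed.

Lemma computable_half F : computable F -> computable (fun v => (F v)./2).
Proof.
move=> cF; apply: (computable_comp2 (F := fun x _ => x./2) _ cF cF).
apply: (computable_primrec (B := fun=> 0) (S := fun x r _ => odd x + r)).
- by [].
- by move=> x _; rewrite /= uphalf_half.
- by computable_basic.
by apply: computable_add; [apply: computable_odd|]; computable_basic.
Qed.

Lemma computable_exp2 F : computable F -> computable (fun v => 2 ^ F v).
Proof.
move=> cF; apply: (computable_comp2 (F := fun x _ => 2 ^ x) _ cF cF).
apply: (computable_primrec (B := fun=> 1) (S := fun _ r _ => r + r)).
- by [].
- by move=> x _; rewrite expnS mul2n addnn.
- by computable_basic.
by apply: computable_add; computable_basic.
Qed.

(* The step of [CodeSeq.code]: it serves both as a pairing function and as the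
   list constructor, so that codes of words are literally their pickles. *)
HB.lock Definition gd (a b : nat) : nat := 2 ^ a * b.*2.+1.

(** Bounded iteration inverts [gd]: in [gd a b] exactly [a] halvings are possible, and the odd
    number 2b+1 remains. By [ltn_gd] the number itself bounds the iterations required. *)
Definition halve_even n := if odd n then n else n./2.
Fixpoint count_even (x n : nat) : nat :=
  if x is y.+1 then count_even y n + ~~ odd (iter y halve_even n) else 0.
Definition p1 n := count_even n n.
Definition p2 n := (iter n halve_even n)./2.

Lemma iter_halve_even i a b :
  iter i halve_even (gd a b) = gd (a - i) b.
Proof.
rewrite gd.unlock; elim: i => [|i IH]; first by rewrite subn0.
rewrite iterS IH subnS /halve_even; case: (a - i) => [|c].
  by rewrite mul1n oddS odd_double.
by rewrite oddM oddX /= expnS -mulnA mul2n doubleK.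
Qed.

Lemma odd_gd a b : odd (gd a b) = (a == 0).
Proof. by rewrite gd.unlock oddM oddX /= odd_double andbT orbF. Qed.

Lemma ltn_gd a b : a < gd a b.
Proof.
by rewrite gd.unlock; apply: leq_trans (leq_pmulr _ _) => //; apply: ltn_expl.
Qed.

Lemma gd_neq0 a b : gd a b <> 0.
Proof. by have := ltn_gd a b; case: gd. Qed.

Lemma p1K a b : p1 (gd a b) = a.
Proof.
suff H x : count_even x (gd a b) = minn x a.
  by rewrite /p1 H; apply/minn_idPr/ltnW/ltn_gd.
elim: x => [|x IH] /=; first by rewrite min0n.
rewrite IH iter_halve_even odd_gd subn_eq0.
by case: (leqP a x) => /=; lia.
Qed.

Lemma p2K a b : p2 (gd a b) = b.
Proof.
rewrite /p2 iter_halve_even; have /ltnW := ltn_gd a b.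
by rewrite -subn_eq0 => /eqP->; rewrite gd.unlock mul1n /= uphalf_double.
Qed.

(** Makes the empty list its own tail, so that reading past the end of a coded list gives the
    default 0. *)
Lemma p2_0 : p2 0 = 0. Proof. by []. Qed.

Lemma gd_inj a b c d : gd a b = gd c d -> a = c /\ b = d.
Proof.
by move=> E; rewrite -(p1K a b) -{2}(p2K a b) E p1K p2K.
Qed.

Lemma computable_gd F G :
  computable F -> computable G -> computable (fun v => gd (F v) (G v)).
Proof.
move=> cF cG; apply: (@computable_ext (fun v => 2 ^ F v * (G v + G v).+1)).
  by move=> v; rewrite gd.unlock addnn.
by apply: computable_mul; [apply: computable_exp2 | apply/computable_S/computable_add].
Qed.

Lemma computable_halve_even : computable1 halve_even.
Proof.
apply: (@computable_ext (fun v =>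
  if (odd (nth 0 v 0) : nat) == 0 then (nth 0 v 0)./2 else nth 0 v 0)).
  by move=> v; rewrite /halve_even; case: odd.
by apply: computable_if_eq0; [apply: computable_odd | apply: computable_half |];
  computable_basic.
Qed.

Lemma computable_p1 F : computable F -> computable (fun v => p1 (F v)).
Proof.
move=> cF; apply: (computable_comp2 (F := count_even) _ cF cF).
apply: (computable_primrec (B := fun=> 0)
  (S := fun y r n => r + ((odd (iter y halve_even n) : nat) == 0))) => //.
- by move=> x a /=; case: odd.
- by computable_basic.
apply: computable_add; first by computable_basic.
apply/computable_eq0/computable_odd/computable_iter; last 2 first.
- by computable_basic.
- by computable_basic.
exact: computable_halve_even.
Qed.

Lemma computable_p2 F : computable F -> computable (fun v => p2 (F v)).
Proof.
move=> cF; apply/computable_half/computable_iter => //.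
exact: computable_halve_even.
Qed.

Ltac computable_tac :=
  repeat first [ assumption | apply: computable_nth | apply: computable_const
    | apply: computable_S | apply: computable_gd | apply: computable_p1
    | apply: computable_p2 | apply: computable_if_eq0 | apply: computable_neq
    | apply: computable_add | apply: computable_pred ].

(** Minimisation finds the least zero; totality of [F] supplies the positive values below it that
    [re_min] demands. *)
Lemma re_nat_search F (S : nat -> Prop) :
  computable F -> (forall n, S n <-> exists y, F [:: y; n] = 0) -> re_nat S.
Proof.
move=> [f Hf] HS; exists (rf_min f) => n; rewrite HS; split.
- move=> [y /eqP Fy]; have exF : exists y, F [:: y; n] == 0 by exists y.
  case: (ex_minnP exF) => m /eqP Fm minm; exists m; constructor.
    by have := Hf [:: m; n]; rewrite Fm.
  move=> z lt_zm; have := Hf [:: z; n]; case Ez: (F _) => [|k]; last by exists k.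
  by have := minm z; rewrite Ez leqNgt lt_zm => /(_ isT).
- move=> [y H]; exists y; inversion H; subst.
  by apply: (reval_functional (Hf _)).
Qed.

(** * Horn-clause definitions are recursively enumerable *)

Inductive term : Type :=
| Var of nat
| Cst of nat
| Suc of term
| Pr of term & term.

Fixpoint eval (s : seq nat) (t : term) : nat :=
  match t with
  | Var i => nth 0 s i
  | Cst n => n
  | Suc t => (eval s t).+1
  | Pr t u => gd (eval s t) (eval s u)
  end.

(* The conclusion comes first, then the premises; variables are universally
   quantified. *)
Definition clause := (term * seq term)%type.

Inductive derivable (cs : seq clause) : nat -> Prop :=
| derivable_clause c s : List.In c cs ->
    (forall p, List.In p c.2 -> derivable cs (eval s p)) ->
    derivable cs (eval s c.1).

Definition code_list (s : seq nat) : nat := foldr gd 0 s.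

(** Allows soundness to read any number met by the search as an assignment. *)
Lemma code_list_surj n : exists s, n = code_list s.
Proof.
exists (CodeSeq.decode n); rewrite -{1}(CodeSeq.decodeK n) /code_list.
by rewrite gd.unlock.
Qed.

Lemma p1_iter_p2 s i : p1 (iter i p2 (code_list s)) = nth 0 s i.
Proof.
elim: i s => [|i IH] [|x s] //=; rewrite ?p1K //.
  by rewrite -iterS iterSr p2_0 (IH [::]) nth_nil.
by rewrite -iterS iterSr p2K IH.
Qed.

Fixpoint eval_code (s : nat) (t : term) : nat :=
  match t with
  | Var i => p1 (iter i p2 s)
  | Cst n => n
  | Suc t => (eval_code s t).+1
  | Pr t u => gd (eval_code s t) (eval_code s u)
  end.

Lemma eval_codeE s t : eval_code (code_list s) t = eval s t.
Proof. by elim: t => //= [i|t ->|t -> u ->] //; rewrite p1_iter_p2. Qed.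

Lemma computable_eval_code t F :
  computable F -> computable (fun v => eval_code (F v) t).
Proof.
move=> cF; elim: t => [i|n|t IH|t IHt u IHu] /=; computable_tac.
by elim: i => [|i IH] //=; apply: computable_p2.
Qed.

(* Derivations are checked by a stack machine: an instruction names a clause and
   an assignment, pops the instantiated premises and pushes the conclusion. *)
Fixpoint mismatch (ps : seq term) (s st : nat) : nat :=
  if ps is p :: ps' then
    (st != gd (eval_code s p) (p2 st)) + mismatch ps' s (p2 st)
  else 0.

Definition fire (c : clause) (s st : nat) : nat :=
  if mismatch c.2 s st == 0
  then gd (eval_code s c.1) (iter (size c.2) p2 st) else st.

Fixpoint execute (cs : seq clause) (k s st : nat) : nat :=
  if cs is c :: cs' then
    if k == 0 then fire c s st else execute cs' k.-1 s st
  else st.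

(** A state pairs the remaining program with the stack, and an instruction pairs a clause index with
    a coded assignment. *)
Definition machine_step (cs : seq clause) (x : nat) : nat :=
  gd (p2 (p1 x)) (execute cs (p1 (p1 (p1 x))) (p2 (p1 (p1 x))) (p2 x)).

Lemma computable_mismatch ps F G :
  computable F -> computable G -> computable (fun v => mismatch ps (F v) (G v)).
Proof.
move=> cF; elim: ps G => [|p ps IH] G cG /=; computable_tac.
  exact: computable_eval_code.
by apply: IH; computable_tac.
Qed.

Lemma computable_fire c F G :
  computable F -> computable G -> computable (fun v => fire c (F v) (G v)).
Proof.
move=> cF cG; apply: computable_if_eq0 => //.
  exact: computable_mismatch.
apply: computable_gd; first exact: computable_eval_code.
by elim: (size _) => //= n; apply: computable_p2.
Qed.

Lemma computable_execute cs K F G :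
  computable K -> computable F -> computable G ->
  computable (fun v => execute cs (K v) (F v) (G v)).
Proof.
move=> cK cF cG; elim: cs K cK => [|c cs IH] K cK //=.
apply: computable_if_eq0 => //; first exact: computable_fire.
by apply: IH; computable_tac.
Qed.

Lemma computable_machine_step cs : computable1 (machine_step cs).
Proof.
by rewrite /machine_step; computable_tac; apply: computable_execute; computable_tac.
Qed.

Lemma mismatch_eq0 ps s L :
  mismatch ps (code_list s) (code_list L) = 0 ->
  exists2 L', L = map (eval s) ps ++ L' &
    iter (size ps) p2 (code_list L) = code_list L'.
Proof.
elim: ps L => [|p ps IH] L /=; first by exists L.
move/eqP; rewrite addn_eq0 eqb0 negbK eval_codeE => /andP[/eqP E /eqP].
(* A stack that is too short fails the test, because [gd] never takes the value 0. *)
case: L E => [|x L] /=; first by move/esym/gd_neq0.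
rewrite p2K => /gd_inj[-> _] /IH[L' -> E]; exists L' => //.
by rewrite -iterS iterSr p2K.
Qed.

Lemma fire_match c s L :
  fire c (code_list s) (code_list (map (eval s) c.2 ++ L)) =
  code_list (eval s c.1 :: L).
Proof.
rewrite /fire; case: c => c ps /=; have -> : mismatch ps (code_list s)
    (code_list (map (eval s) ps ++ L)) = 0.
  by elim: ps => //= p ps IH; rewrite eval_codeE p2K eqxx IH.
rewrite eqxx eval_codeE; congr gd.
by elim: ps => //= p ps IH; rewrite -iterS iterSr p2K.
Qed.

(** * Soundness and completeness of the stack machine *)

Section HornMachine.
Variable cs : seq clause.

Definition derived_stack (st : nat) : Prop :=
  exists2 L, st = code_list L & forall x, x \in L -> derivable cs x.

Lemma execute_sound k s st :
  derived_stack st -> derived_stack (execute cs k s st).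
Proof.
(* The induction runs over suffixes of the clause list, while derivability stays relative to all of
   [cs]. *)
have: forall c, List.In c cs -> List.In c cs by [].
elim: {1 3}cs k => //= c cs' IH k sub Hst; case: eqP => _; last first.
  by apply: IH => // d Hd; apply: sub; right.
have [s' ->] := code_list_surj s; case: Hst => L -> HL; rewrite /fire.
case: eqP => [/mismatch_eq0[L' E ->]|_]; last by exists L.
exists (eval s' c.1 :: L'); first by rewrite /= eval_codeE.
move=> x; rewrite inE => /orP[/eqP->|xL']; last first.
  by apply: HL; rewrite E mem_cat xL' orbT.
apply: derivable_clause; first by apply: sub; left.
move=> p Hp; apply: HL; rewrite E mem_cat; apply/orP; left.
by elim: c.2 Hp => //= q qs IHq [->|/IHq]; rewrite inE ?eqxx // => ->; rewrite orbT.
Qed.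

Lemma run_sound n x :
  derived_stack (p2 x) -> derived_stack (p2 (iter n (machine_step cs) x)).
Proof.
move=> H; elim: n => //= n IH; rewrite {1}/machine_step p2K.
exact: execute_sound.
Qed.

(** Quantifying over the instructions [pr'] still to come is what lets runs be concatenated. *)
Definition runs (pr : seq nat) (L L' : seq nat) : Prop :=
  forall pr', iter (size pr) (machine_step cs) (gd (code_list (pr ++ pr')) (code_list L))
    = gd (code_list pr') (code_list L').

Lemma runs_cat pr qr L L' L'' :
  runs pr L L' -> runs qr L' L'' -> runs (pr ++ qr) L L''.
Proof. by move=> H1 H2 pr'; rewrite size_cat addnC iterD -catA H1 H2. Qed.

Lemma execute_complete c s L : List.In c cs ->
  exists k, execute cs k (code_list s) (code_list (map (eval s) c.2 ++ L)) =
            code_list (eval s c.1 :: L).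
Proof.
elim: cs => //= d cs' IH [->|/IH[k Hk]]; first by exists 0; rewrite eqxx fire_match.
by exists k.+1.
Qed.

Lemma run_complete n : derivable cs n ->
  forall L, exists pr, runs pr L (n :: L).
Proof.
elim=> c s Hc _ IH L.
have [pr Hpr] : exists pr, runs pr L (map (eval s) c.2 ++ L).
  (* The premises are pushed from last to first, so that the first ends on top, as [fire]
     expects. *)
  elim: c.2 IH => [|p ps IHps] IH; first by exists [::].
  have [|pr Hpr] := IHps; first by move=> q Hq; apply: IH; right.
  have [qr Hqr] := IH p (or_introl erefl) (map (eval s) ps ++ L).
  by exists (pr ++ qr); apply: runs_cat Hpr Hqr.
have [k Hk] := execute_complete s L Hc.
exists (pr ++ [:: gd k (code_list s)]); apply: runs_cat Hpr _ => pr' /=.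
by rewrite /machine_step !(p1K, p2K) Hk.
Qed.

Theorem re_derivable (t : term) : re_nat (fun n => derivable cs (eval [:: n] t)).
Proof.
(* The number sought pairs a step count with a program. It succeeds when the run from the empty
   stack leaves the value of [t] alone; [gd n 0] codes the assignment [[:: n]]. *)
apply: (@re_nat_search (fun v =>
  (p2 (iter (p1 (nth 0 v 0)) (machine_step cs) (gd (p2 (nth 0 v 0)) 0))
   != gd (eval_code (gd (nth 0 v 1) 0) t) 0) : nat)).
  apply: computable_neq.
    by apply: computable_p2; apply: computable_iter;
      [exact: computable_machine_step | computable_tac | computable_tac].
  by computable_tac; apply: computable_eval_code; computable_tac.
move=> n /=; split.
- move=> H; have [pr Hpr] := run_complete H [::].
  exists (gd (size pr) (code_list pr)); rewrite p1K p2K.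
  have := Hpr [::]; rewrite cats0 /= => ->.
  by rewrite p2K -(eval_codeE [:: n]) /= eqxx.
- move=> [y /eqP]; rewrite eqb0 negbK => /eqP E.
  have: derived_stack (p2 (gd (p2 y) 0)) by rewrite p2K; exists [::].
  move/(run_sound (p1 y)); rewrite E (eval_codeE [:: n]) => -[[|x L] /=].
    by move/gd_neq0.
  by move/gd_inj=> [-> _]; apply; rewrite mem_head.
Qed.

End HornMachine.

(** * Torsion-free closure of a free product *)

Section PresentedGroup.
Variable P : presentation.

Lemma peq_catl a u v : peq P u v -> peq P (a ++ u) (a ++ v).
Proof. by move=> H; have := peq_ctx a [::] H; rewrite !cats0. Qed.

Lemma peq_catr c u v : peq P u v -> peq P (u ++ c) (v ++ c).
Proof. exact: (peq_ctx [::] c). Qed.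

Lemma winv_cat u v : winv (u ++ v) = winv v ++ winv u.
Proof. by rewrite /winv map_cat rev_cat. Qed.

Lemma winvK w : winv (winv w) = w.
Proof.
rewrite /winv map_rev revK -map_comp -[RHS]map_id; apply: eq_map => -[x b].
by rewrite /linv /= negbK.
Qed.

Lemma peq_mulV w : peq P (w ++ winv w) [::].
Proof.
elim: w => [|l w IH]; first exact: peq_refl.
rewrite -cat1s winv_cat -catA (catA w).
apply: peq_trans (peq_cancel P l); apply: peq_catl.
exact: (peq_catr (winv [:: l]) IH).
Qed.

Lemma peq_winv w : peq P (winv w) [::] <-> peq P w [::].
Proof.
have H u : peq P u [::] -> peq P (winv u) [::].
  by move=> /(peq_catr (winv u))/peq_sym Hu; apply: peq_trans Hu (peq_mulV u).
by split=> /H; rewrite ?winvK.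
Qed.

Lemma winv_flatten_nseq k w : winv (flatten (nseq k w)) = flatten (nseq k (winv w)).
Proof. by rewrite /winv map_flatten rev_flatten !map_nseq rev_nseq. Qed.

(** A negative power is the inverse of a positive one, so the root rule can be phrased with absolute
    values. *)
Lemma peq_wpow_abs w n :
  peq P (wpow w n) [::] <-> peq P (flatten (nseq (absz n) w)) [::].
Proof.
case: n => k; first by [].
by rewrite /wpow -winv_flatten_nseq; apply: peq_winv.
Qed.

End PresentedGroup.

Lemma hom_word_cat phi u v : hom_word phi (u ++ v) = hom_word phi u ++ hom_word phi v.
Proof. by rewrite /hom_word map_cat flatten_cat. Qed.

Lemma hom_word_power phi k w :
  hom_word phi (flatten (nseq k w)) = flatten (nseq k (hom_word phi w)).
Proof. by elim: k => //= k IH; rewrite hom_word_cat IH. Qed.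

Definition shift (i : nat) (w : word) : word := map (fun l => (gd i l.1, l.2)) w.

Section TorsionFreeClosure.
Variables (R : nat -> word -> Prop) (A : int -> Prop).

(* Only left congruence is imposed; rules with a common right factor make right
   congruence admissible (weq_catr). *)
Inductive weq : word -> word -> Prop :=
| weq_refl u : weq u u
| weq_sym u v : weq u v -> weq v u
| weq_trans u v w : weq u v -> weq v w -> weq u w
| weq_cons l u v : weq u v -> weq (l :: u) (l :: v)
| weq_cancel l u : weq (l :: linv l :: u) u
| weq_rel i r u : R i r -> weq (shift i r ++ u) u
| weq_root w n u : A n -> weq (flatten (nseq (absz n) w)) [::] -> weq (w ++ u) u.

Lemma weq_catl a u v : weq u v -> weq (a ++ u) (a ++ v).
Proof. by move=> H; elim: a => //= l a; apply: weq_cons. Qed.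

Lemma weq_catr c u v : weq u v -> weq (u ++ c) (v ++ c).
Proof.
elim=> {u v} [u|u v _ IH|u v w _ IHu _ IHv|l u v _ IH|l u|i r u Rr|w n u An Hw _].
- exact: weq_refl.
- exact: weq_sym.
- exact: weq_trans IHu IHv.
- exact: weq_cons.
- exact: weq_cancel.
- by rewrite -catA; apply: weq_rel.
- by rewrite -catA; apply: weq_root An Hw.
Qed.

Definition universal_pres : presentation :=
  @Presentation (fun=> True) (fun w => weq w [::]) (fun _ _ _ _ => I).

Lemma peq_universal u v : peq universal_pres u v -> weq u v.
Proof.
elim=> {u v} [u|u v _ IH|u v w _ IHu _ IHv|a u v c _ IH|l|r] //.
- exact: weq_refl.
- exact: weq_sym.
- exact: weq_trans IHu IHv.
- exact/weq_catl/weq_catr.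
- exact: weq_cancel.
Qed.

(** [weq_root] trivialises any word with a trivial [A]-power, and trivial words are relators. *)
Lemma torsion_free_universal : torsion_free A universal_pres.
Proof.
move=> w _ n An /peq_wpow_abs/peq_universal Hw; apply: peq_rel => /=.
by rewrite -(cats0 w); apply: weq_root An Hw.
Qed.

(** * Retraction onto one copy *)

Section Retraction.
Variables (P : presentation) (i : nat).
Hypothesis tfP : torsion_free A P.
Hypothesis relP : forall r, rels P r <-> R i r.

(* Collapses the other copies, and the generators that P does not have. *)
Definition retract (g : nat) : word :=
  if p1 g == i then
    if excluded_middle_informative (gens P (p2 g)) then [:: (p2 g, false)] else [::]
  else [::].

(** Torsion-freeness of [P] concerns only words over its generators, so images must be such words
    before it applies. *)
Lemma retract_over w : word_over P (hom_word retract w).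
Proof.
move=> l /flattenP[u /mapP[[g b] _ ->]] /=; rewrite /retract.
case: eqP => _; last by case: b.
by case: (excluded_middle_informative _) => Pg; case: b => //; rewrite inE => /eqP->.
Qed.

Lemma retract_cancel l : peq P (hom_word retract [:: l; linv l]) [::].
Proof.
case: l => g [] /=; rewrite /hom_word /= cats0; last exact: peq_mulV.
rewrite -{2}(winvK (retract g)); exact: peq_mulV.
Qed.

Lemma retract_shift w : word_over P w -> hom_word retract (shift i w) = w.
Proof.
elim: w => //= -[x b] w IH Pw; rewrite -cat1s hom_word_cat IH; last first.
  by move=> l lw; apply: Pw; rewrite inE lw orbT.
rewrite -[RHS]cat1s; congr cat.
have Px : gens P x by apply: (Pw (x, b)); rewrite mem_head.
rewrite /hom_word /retract /= p1K p2K eqxx.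
by case: excluded_middle_informative => [Px'|/(_ Px)] //; case: (b).
Qed.

Lemma retract_shift_other j w : j != i -> hom_word retract (shift j w) = [::].
Proof.
move=> ji; elim: w => //= -[x b] w IH; rewrite -cat1s hom_word_cat IH cats0.
by rewrite /hom_word /retract /= p1K (negPf ji); case: b.
Qed.

Lemma retract_weq u v : weq u v -> peq P (hom_word retract u) (hom_word retract v).
Proof.
elim=> {u v} [u|u v _ IH|u v w _ IHu _ IHv|l u v _ IH|l u|j r u Rr|w n u An _ IH].
- exact: peq_refl.
- exact: peq_sym.
- exact: peq_trans IHu IHv.
- by rewrite -(cat1s l u) -(cat1s l v) !hom_word_cat; apply: peq_catl.
- rewrite -[l :: _]/([:: l; linv l] ++ u) hom_word_cat.
  by apply: peq_catr (retract_cancel l).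
- rewrite hom_word_cat; have [E|ji] := eqVneq j i; last first.
    by rewrite retract_shift_other //; apply: peq_refl.
  subst j; have /relP Pr := Rr; rewrite retract_shift; last exact: rels_over Pr.
  exact: (peq_catr _ (peq_rel Pr)).
(* The image of the power is the power of the image, trivial in [P] by induction; torsion-freeness
   of [P] then makes the image of [w] trivial. *)
- rewrite hom_word_cat; rewrite hom_word_power in IH.
  have Hw : peq P (hom_word retract w) [::].
    by move: (tfP (@retract_over w) An); apply; apply/peq_wpow_abs.
  exact: (peq_catr _ Hw).
Qed.

Lemma embeds_universal : embeds P universal_pres.
Proof.
exists (fun x => [:: (gd i x, false)]).
have homE w : hom_word (fun x => [:: (gd i x, false)]) w = shift i w.
  by elim: w => //= -[x []] w; rewrite /hom_word /= => ->.
split=> // [r /relP Rr|w Pw].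
  by apply: peq_rel; rewrite homE /= -(cats0 (shift i r)); apply: weq_rel.
(* Injectivity: retracting the image of [w] gives back [w] itself. *)
by rewrite homE => /peq_universal/retract_weq; rewrite retract_shift.
Qed.

End Retraction.
End TorsionFreeClosure.

(** * Enumerating the relators *)

Fixpoint code_recfun (f : recfun) : nat :=
  match f with
  | rf_zero => gd 0 0
  | rf_succ => gd 1 0
  | rf_proj i => gd 2 i
  | rf_comp f gs => gd 3 (gd (code_recfun f) (code_list (map code_recfun gs)))
  | rf_prec f g => gd 4 (gd (code_recfun f) (code_recfun g))
  | rf_min f => gd 5 (code_recfun f)
  end.

Definition code_letter (l : letter) : nat := gd l.1 (gd l.2 0).
Definition code_word (w : word) : nat := code_list (map code_letter w).

Lemma pickle_word w : pickle w = code_word w.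
Proof.
elim: w => [|[x b] w IH]; first by [].
rewrite /code_word /= -/(code_word w) -IH /code_letter.
by rewrite gd.unlock.
Qed.

(** An integer is pickled as a pair of options, each a list with at most one entry; the [tTors]
    clauses match these shapes. *)
Lemma pickle_Posz k : pickle (Posz k) = gd (gd k 0) (gd 0 0).
Proof. by rewrite gd.unlock. Qed.

Lemma pickle_Negz k : pickle (Negz k) = gd 0 (gd (gd k 0) 0).
Proof. by rewrite gd.unlock. Qed.

(* The judgements of the Horn system: [Ev f v y] is evaluation of the recursive
   function coded by f, [Evs] its pointwise version, [Pos f v y] says that f takes
   positive values on z :: v for all z < y; [Tors k] says that A contains k or -k,
   and [Eq] is [weq]. *)
Notation judgement k a b c := (gd k (gd a (gd b c))).
Notation jEv f v y := (judgement 0 f v y).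
Notation jNth v i x := (judgement 3 v i x).
Notation jCat u v w := (judgement 4 u v w).
Notation jPow w k z := (judgement 5 w k z).
Notation jShift i r r' := (judgement 6 i r r').
Notation jWord w := (judgement 7 w 0 0).
Notation jTors k := (judgement 8 k 0 0).
Notation jEq u v := (judgement 9 u v 0).

Notation tjudgement k a b c := (Pr (Cst k) (Pr a (Pr b c))).
Notation tEv f v y := (tjudgement 0 f v y).
Notation tEvs gs v ys := (tjudgement 1 gs v ys).
Notation tPos f v y := (tjudgement 2 f v y).
Notation tNth v i x := (tjudgement 3 v i x).
Notation tCat u v w := (tjudgement 4 u v w).
Notation tPow w k z := (tjudgement 5 w k z).
Notation tShift i r r' := (tjudgement 6 i r r').
Notation tWord w := (tjudgement 7 w (Cst 0) (Cst 0)).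
Notation tTors k := (tjudgement 8 k (Cst 0) (Cst 0)).
Notation tEq u v := (tjudgement 9 u v (Cst 0)).
Notation tLetter x b := (Pr x (Pr (Cst b) (Cst 0))).

(** Not every number codes a word, so [tWord] premises keep both sides of [tEq] genuine. The two
    [tTors] clauses read [Posz a] and [Negz a], of absolute values [a] and [a.+1]. *)
Definition horn (cA : nat) : seq clause :=
  let a := Var 0 in let b := Var 1 in let c := Var 2 in let d := Var 3 in
  let e := Var 4 in let g := Var 5 in let o := Cst 0 in
  [:: (tEv (Pr (Cst 0) o) a o, [::]);
      (tEv (Pr (Cst 1) o) a (Suc b), [:: tNth a o b]);
      (tEv (Pr (Cst 2) b) a c, [:: tNth a b c]);
      (tEv (Pr (Cst 3) (Pr a b)) c e, [:: tEvs b c d; tEv a d e]);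
      (tEv (Pr (Cst 4) (Pr a b)) (Pr o c) d, [:: tEv a c d]);
      (tEv (Pr (Cst 4) (Pr a b)) (Pr (Suc c) d) g,
        [:: tEv (Pr (Cst 4) (Pr a b)) (Pr c d) e; tEv b (Pr c (Pr e d)) g]);
      (tEv (Pr (Cst 5) a) b c, [:: tEv a (Pr c b) o; tPos a b c]);
      (tEvs o a o, [::]);
      (tEvs (Pr a b) c (Pr d e), [:: tEv a c d; tEvs b c e]);
      (tPos a b o, [::]);
      (tPos a b (Suc c), [:: tPos a b c; tEv a (Pr c b) (Suc d)]);
      (tNth o a o, [::]);
      (tNth (Pr a b) o a, [::]);
      (tNth (Pr a b) (Suc c) d, [:: tNth b c d]);
      (tCat o a a, [::]);
      (tCat (Pr a b) c (Pr a d), [:: tCat b c d]);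
      (tPow a o o, [::]);
      (tPow a (Suc b) d, [:: tPow a b c; tCat a c d]);
      (tShift a o o, [::]);
      (tShift a (Pr (Pr b c) d) (Pr (Pr (Pr a b) c) e), [:: tShift a d e]);
      (tWord o, [::]);
      (tWord (Pr (tLetter a 0) b), [:: tWord b]);
      (tWord (Pr (tLetter a 1) b), [:: tWord b]);
      (tTors a, [:: tEv (Cst cA) (Pr (Pr (Pr a o) (Pr o o)) o) b]);
      (tTors (Suc a), [:: tEv (Cst cA) (Pr (Pr o (Pr (Pr a o) o)) o) b]);
      (tEq a a, [:: tWord a]);
      (tEq b a, [:: tEq a b]);
      (tEq a c, [:: tEq a b; tEq b c]);
      (tEq (Pr a b) (Pr a c), [:: tWord (Pr a o); tEq b c]);
      (tEq (Pr (tLetter a 0) (Pr (tLetter a 1) b)) b, [:: tWord b]);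
      (tEq (Pr (tLetter a 1) (Pr (tLetter a 0) b)) b, [:: tWord b]);
      (tEq g e, [:: tWord b; tEv a (Pr b o) c; tShift a b d; tWord e; tCat d e g]);
      (tEq e d, [:: tWord a; tTors b; tPow a b c; tEq c o; tWord d; tCat a d e])].

(** For a concrete clause the right-hand side computes to a conjunction with one factor per
    premise. *)
Lemma In_foldr T (Q : T -> Prop) ps :
  (forall p, List.In p ps -> Q p) <-> foldr (fun p X => Q p /\ X) True ps.
Proof.
elim: ps => [|p ps IH] //=; split=> [H|[Hp /IH H] q [<-|/H]] //.
by split; [apply: H; left | apply/IH => q Hq; apply: H; right].
Qed.

Lemma derivable_nth cs k s (c := nth (Cst 0, [::]) cs k) :
  k < size cs ->
  foldr (fun p X => derivable cs (eval s p) /\ X) True c.2 ->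
  derivable cs (eval s c.1).
Proof.
move=> ltk /In_foldr H; apply: derivable_clause => //.
by rewrite /c {H c}; elim: cs k ltk => [|c cs IH] [|k] //= ltk;
  [left | right; apply: IH].
Qed.

Ltac derive k s := apply: (@derivable_nth _ k s) => //=.

Section Enumeration.
Variables (A : int -> Prop) (fA : recfun).
Hypothesis fAP : forall n : nat,
  (exists x : int, pickle x = n /\ A x) <-> exists y, reval fA [:: n] y.

Let cs := horn (code_recfun fA).
Local Notation der := (derivable cs).

(** * Completeness of the Horn system *)

Lemma der_nth v i : der (jNth (code_list v) i (nth 0 v i)).
Proof.
elim: v i => [|x v IH] [|i] /=.
- by derive 11 [:: 0].
- by derive 11 [:: i.+1].
- by derive 12 [:: x; code_list v].
- by derive 13 [:: x; code_list v; i; nth 0 v i].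
Qed.

Lemma der_eval f v y :
  reval f v y -> der (jEv (code_recfun f) (code_list v) y).
Proof.
move: f v y; apply: reval_nested_ind => /=.
- by move=> v; derive 0 [:: code_list v].
- move=> v; derive 1 [:: code_list v; nth 0 v 0].
  by split=> //; apply: der_nth.
- move=> i v; derive 2 [:: code_list v; i; nth 0 v i].
  by split=> //; apply: der_nth.
- move=> f gs v ys y Hgs Hf.
  derive 3 [:: code_recfun f; code_list (map code_recfun gs); code_list v; code_list ys; y].
  split=> //; elim: Hgs {Hf} => [|g z {}gs {}ys Hg _ IH] /=.
    by derive 7 [:: code_list v].
  by derive 8 [:: code_recfun g; code_list (map code_recfun gs); code_list v; z; code_list ys].
- move=> f g v y Hf.
  by derive 4 [:: code_recfun f; code_recfun g; code_list v; y].
- move=> f g x v r y Hr Hy.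
  by derive 5 [:: code_recfun f; code_recfun g; x; code_list v; r; y].
- move=> f v y H0 H; derive 6 [:: code_recfun f; code_list v; y].
  (* The bounded universal premise of minimisation becomes a chain of [tPos] facts, one for each
     step up to [y]. *)
  split=> //; split=> //; elim: y H {H0} => [|y IH] H.
    by derive 9 [:: code_recfun f; code_list v].
  have [k Hk] := H y (ltnSn y).
  derive 10 [:: code_recfun f; code_list v; y; k]; split=> //.
  by apply: IH => z lt_zy; apply: H; apply: ltnW.
Qed.

Lemma der_cat u v : der (jCat (code_list u) (code_list v) (code_list (u ++ v))).
Proof.
elim: u => [|x u IH] /=; first by derive 14 [:: code_list v].
by derive 15 [:: x; code_list u; code_list v; code_list (u ++ v)].
Qed.

Lemma der_cat_word u v : der (jCat (code_word u) (code_word v) (code_word (u ++ v))).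
Proof. by rewrite /code_word map_cat; apply: der_cat. Qed.

Lemma der_pow w k : der (jPow (code_word w) k (code_word (flatten (nseq k w)))).
Proof.
elim: k => [|k IH]; first by derive 16 [:: code_word w].
derive 17 [:: code_word w; k; code_word (flatten (nseq k w)); code_word (flatten (nseq k.+1 w))].
by split=> //; split=> //; apply: der_cat_word.
Qed.

Lemma der_shift i r : der (jShift i (code_word r) (code_word (shift i r))).
Proof.
elim: r => [|[x b] r IH]; first by derive 18 [:: i].
by derive 19 [:: i; x; gd b 0; code_word r; code_word (shift i r)].
Qed.

Lemma der_word w : der (jWord (code_word w)).
Proof.
elim: w => [|[x []] w IH]; first by derive 20 [:: 0].
- by derive 22 [:: x; code_word w].
- by derive 21 [:: x; code_word w].
Qed.

Lemma der_tors n : A n -> der (jTors (absz n)).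
Proof.
move=> An; have [|y /der_eval Hy] := proj1 (fAP (pickle n)); first by exists n.
case: n An Hy => k _ Hy; rewrite ?pickle_Posz ?pickle_Negz in Hy.
- by derive 23 [:: k; y].
- by derive 24 [:: k; y].
Qed.

(* Any number may index a copy; those that are not codes of recursive functions
   do no harm. *)
Definition enum_rels (i : nat) (r : word) : Prop :=
  exists y, der (jEv i (code_list [:: code_word r]) y).

Lemma der_weq u v : weq enum_rels A u v -> der (jEq (code_word u) (code_word v)).
Proof.
elim=> {u v} [u|u v _ IH|u v w _ IHu _ IHv|l u v _ IH|l u|i r u [y Hy]|w n u An _ IH].
- derive 25 [:: code_word u]; split=> //; exact: der_word.
- by derive 26 [:: code_word u; code_word v].
- by derive 27 [:: code_word u; code_word v; code_word w].
- derive 28 [:: code_letter l; code_word u; code_word v].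
  by split=> //; apply: (der_word [:: l]).
- case: l => x [].
  + derive 30 [:: x; code_word u]; split=> //; exact: der_word.
  + derive 29 [:: x; code_word u]; split=> //; exact: der_word.
- derive 31 [:: i; code_word r; y; code_word (shift i r); code_word u;
               code_word (shift i r ++ u)].
  split; first exact: der_word; split=> //; split; first exact: der_shift.
  by split; [exact: der_word | split=> //; exact: der_cat_word].
- derive 32 [:: code_word w; absz n; code_word (flatten (nseq (absz n) w));
               code_word u; code_word (w ++ u)].
  split; first exact: der_word; split; first exact: der_tors.
  split; first exact: der_pow; split=> //.
  by split; [exact: der_word | split=> //; exact: der_cat_word].
Qed.

(** * Soundness of the Horn system *)

(** Judgements about evaluation, lists and shifts are conditional on their inputs being codes, hence
    vacuous on other numbers; [jWord] and [jEq] assert that their arguments decode. *)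
Definition meaning (k a b c : nat) : Prop :=
  match k with
  | 0 => forall f v, a = code_recfun f -> b = code_list v -> reval f v c
  | 1 => forall gs v, a = code_list (map code_recfun gs) -> b = code_list v ->
      exists2 ys, c = code_list ys & Forall2 (fun g y => reval g v y) gs ys
  | 2 => forall f v, a = code_recfun f -> b = code_list v ->
      forall z, z < c -> exists k, reval f (z :: v) k.+1
  | 3 => forall v, a = code_list v -> c = nth 0 v b
  | 4 => forall u v, a = code_list u -> b = code_list v -> c = code_list (u ++ v)
  | 5 => forall w, a = code_list w -> c = code_list (flatten (nseq b w))
  | 6 => forall r, b = code_word r -> c = code_word (shift a r)
  | 7 => exists w, a = code_word w
  | 8 => exists2 n, A n & absz n = a
  | _ => exists u v, [/\ a = code_word u, b = code_word v & weq enum_rels A u v]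
  end.

Definition sound (n : nat) : Prop :=
  meaning (p1 n) (p1 (p2 n)) (p1 (p2 (p2 n))) (p2 (p2 (p2 n))).

Lemma soundE k a b c : sound (judgement k a b c) = meaning k a b c.
Proof. by rewrite /sound !(p1K, p2K). Qed.

Lemma code_list_cons x n s : gd x n = code_list s ->
  exists2 s', s = x :: s' & n = code_list s'.
Proof. by case: s => [/gd_neq0|y s /gd_inj[-> ->]] //; exists s. Qed.

Lemma code_list_nil s : 0 = code_list s -> s = [::].
Proof. by case: s => // x s /esym/gd_neq0. Qed.

Lemma code_list_inj : injective code_list.
Proof.
by elim=> [|x s IH] t; [move/code_list_nil | move/code_list_cons=> [t' -> /IH->]].
Qed.

Lemma code_word_cons x n w : gd x n = code_word w ->
  exists l w', [/\ w = l :: w', x = code_letter l & n = code_word w'].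
Proof. by case: w => [/gd_neq0|l w /gd_inj[-> ->]] //; exists l, w. Qed.

Lemma code_letter_inj : injective code_letter.
Proof. by move=> [x b] [y d] /gd_inj[/= -> /gd_inj[]]; case: b d => [] []. Qed.

Lemma code_word_inj : injective code_word.
Proof. exact: inj_comp code_list_inj (inj_map code_letter_inj). Qed.

Lemma code_map_cons x n gs : gd x n = code_list (map code_recfun gs) ->
  exists g gs', [/\ gs = g :: gs', x = code_recfun g & n = code_list (map code_recfun gs')].
Proof. by case: gs => [/gd_neq0|g gs /gd_inj[-> ->]] //; exists g, gs. Qed.

Lemma code_cat_word w u c : meaning 4 (code_word w) (code_word u) c ->
  c = code_word (w ++ u).
Proof. by rewrite /code_word map_cat; apply. Qed.

Ltac code_recfun_cases f :=
  case: f => [| |?|? ?|? ?|?] /= /gd_inj [] //.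

Lemma der_sound n : der n -> sound n.
Proof.
elim=> {n} cl s Hcl /In_foldr Hder /In_foldr; move: Hder.
move: Hcl; rewrite /cs /horn /=.
(* One goal for each clause of [horn], in the same order. Each keeps the derivability of the
   premises beside their soundness. *)
do 33?(case=> [<-|]) => //=.
all: rewrite !soundE.
all: move: (nth 0 s 0) (nth 0 s 1) (nth 0 s 2) (nth 0 s 3) (nth 0 s 4) (nth 0 s 5).
all: move=> a b c d e g /=.
- move=> _ _ f v; code_recfun_cases f => _ _ _; exact: re_zero.
- move=> _ [H _] f v; code_recfun_cases f => _ _ E; rewrite (H v E); exact: re_succ.
- move=> _ [H _] f v; code_recfun_cases f => _ Ei E; rewrite (H v E) Ei; exact: re_proj.
- move=> _ [Hs [Hf _]] f v; code_recfun_cases f => _ /gd_inj[Ef Egs] Ev.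
  have [ys Eys Hys] := Hs _ _ Egs Ev.
  exact: re_comp Hys (Hf _ _ Ef Eys).
- move=> _ [H _] f v; code_recfun_cases f => _ /gd_inj[Ef _].
  by move/code_list_cons=> [v' -> Ev]; constructor; apply: H.
- move=> _ [Hr [Hy _]] f v; code_recfun_cases f => _ /gd_inj[Ef Eg].
  move/code_list_cons=> [v' -> Ev]; apply: re_precS.
    by apply: Hr; rewrite /= ?Ef ?Eg ?Ev.
  by apply: Hy => //=; rewrite Ev.
- move=> _ [H0 [H _]] f v; code_recfun_cases f => _ Ef Ev; constructor.
    by apply: H0 => //=; rewrite Ev.
  exact: H.
- by move=> _ _ [|g' gs] v; [exists [::] | move/esym/gd_neq0].
- move=> _ [Hg [Hgs _]] fs v /code_map_cons[f [fs' [-> Ef Efs]]] Ev.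
  have [ys Eys Hys] := Hgs _ _ Efs Ev.
  exists (d :: ys); first by rewrite /= Eys.
  by constructor; [apply: Hg | ].
- by [].
- move=> _ [H [Hy _]] f v Ef Ev z; rewrite ltnS leq_eqVlt => /orP[/eqP->|].
    by exists d; apply: Hy => //=; rewrite Ev.
  exact: H.
- by move=> _ _ v /code_list_nil->; rewrite nth_nil.
- by move=> _ _ v /code_list_cons[v' -> _].
- by move=> _ [H _] v /code_list_cons[v' -> Ev]; apply: H.
- by move=> _ _ u v /code_list_nil-> ->.
- by move=> _ [H _] u v /code_list_cons[u' -> Eu] Ev /=; rewrite (H _ _ Eu Ev).
- by [].
- by move=> _ [Hz [H _]] w Ew; apply: H => //=; apply: Hz.
- by move=> _ _ [|l r] // /esym/gd_neq0.
- move=> _ [H _] r /code_word_cons[[x y] [r' [-> /gd_inj[-> ->] Er]]].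
  by rewrite (H _ Er).
- by exists [::].
- by move=> _ [[w ->] _]; exists ((a, false) :: w).
- by move=> _ [[w ->] _]; exists ((a, true) :: w).
- move=> _ [H _]; have /(proj2 (fAP _)) [n [En An]] : exists y, reval fA [:: pickle (Posz a)] y.
    by exists b; apply: H; rewrite ?pickle_Posz.
  by exists n => //; rewrite (pcan_inj pickleK En).
- move=> _ [H _]; have /(proj2 (fAP _)) [n [En An]] : exists y, reval fA [:: pickle (Negz a)] y.
    by exists b; apply: H; rewrite ?pickle_Negz.
  by exists n => //; rewrite (pcan_inj pickleK En).
- by move=> _ [[w ->] _]; exists w, w; split=> //; apply: weq_refl.
- by move=> _ [[u [v [-> -> H]]] _]; exists v, u; split=> //; apply: weq_sym.
- move=> _ [[u [v [-> -> H]]] [[v' [w [/code_word_inj<- -> H']]] _]].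
  by exists u, w; split=> //; apply: weq_trans H H'.
- move=> _ [[w /code_word_cons[l [_ [_ -> _]]]] [[u [v [-> -> H]]] _]].
  by exists (l :: u), (l :: v); split=> //; apply: weq_cons.
- move=> _ [[w ->] _]; exists [:: (a, false), (a, true) & w], w; split=> //.
  exact: (weq_cancel _ _ (a, false)).
- move=> _ [[w ->] _]; exists [:: (a, true), (a, false) & w], w; split=> //.
  exact: (weq_cancel _ _ (a, true)).
(* The index [a] may code no recursive function, so the derivability of the evaluation premise is
   used: [enum_rels] is defined by it. *)
- move=> [_ [Hev _]] [[r Er] [_ [Hsh [[u Eu] [Hcat _]]]]]; subst b e.
  rewrite (Hsh r erefl) in Hcat; exists (shift a r ++ u), u; split=> //.
    exact: code_cat_word Hcat.
  by apply: weq_rel; exists c.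
- move=> _ [[w Ew] [[n An En] [Hp [[z [z' [Ez Ez' Hz]]] [[u Eu] [Hcat _]]]]]]; subst a b d.
  exists (w ++ u), u; split=> //; first exact: code_cat_word Hcat.
  have Ez0 : [::] = z' by apply: code_word_inj.
  have Ezw : z = flatten (nseq (absz n) w).
    apply: code_word_inj; rewrite -Ez (Hp _ erefl) /code_word map_flatten.
    by rewrite map_nseq.
  by apply: weq_root An _; rewrite -Ezw Ez0.
Qed.

Lemma re_weq : re_set (fun w : word => weq enum_rels A w [::]).
Proof.
(* The empty word has code 0. *)
have [f Hf] := re_derivable cs (tEq (Var 0) (Cst 0)).
exists f => n; rewrite -Hf /=; split.
  by move=> [w [<- /der_weq]]; rewrite pickle_word.
move/der_sound; rewrite soundE => -[u [v [Eu Ev Huv]]].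
have Ev0 : [::] = v by apply: code_word_inj.
by exists u; rewrite pickle_word Ev0.
Qed.

(** By completeness and soundness of [jEv] on genuine codes, the copy indexed by the code of [f]
    carries exactly the relators that [f] accepts. *)
Lemma enum_rels_complete (f : recfun) (S : word -> Prop) :
  (forall n, (exists w : word, pickle w = n /\ S w) <-> exists y, reval f [:: n] y) ->
  forall r, S r <-> enum_rels (code_recfun f) r.
Proof.
move=> Hf r; split.
  move=> Sr; have [|y /der_eval Hy] := proj1 (Hf (pickle r)); first by exists r.
  by exists y; rewrite -pickle_word.
move=> [y /der_sound]; rewrite soundE => /(_ f [:: code_word r] erefl erefl) Hy.
have [|w [Ew Sw]] := proj2 (Hf (code_word r)); first by exists y.
by rewrite pickle_word in Ew; rewrite -(code_word_inj Ew).
Qed.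

End Enumeration.

Theorem theorem2p9 (A : int -> Prop) :
  re_set A ->
  exists Q : presentation,
    [/\ recursive_pres Q,
        torsion_free A Q
      & forall P : presentation, recursive_pres P -> torsion_free A P ->
          embeds P Q].
Proof.
move=> [fA fAP]; exists (universal_pres (enum_rels fA) A); split.
- split; last exact: re_weq.
  (* All numbers are generators, and their set is the domain of a total function. *)
  exists rf_zero => n; split=> _; first by exists 0; constructor.
  by exists n.
- exact: torsion_free_universal.
(* [P] goes to the copy indexed by the code of a function accepting its relators. *)
- move=> P [_ [f Hf]] tfP; apply: (embeds_universal (i := code_recfun f)) => //.
  exact: enum_rels_complete.
Qed.
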